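(* Let $G$ be any functional digraph with $n$ vertices and $k < n$ edges. Let $$H := S_k \sqcup \Big(\bigsqcup_{i=1}^{n-k-1} S_0\Big).$$ Then $A_G \preceq A_H$, and $H$ has successor-closed counting polynomial $$A_H(x) = (1+x)^{n-k-1}\big(1 + x(1+x)^k\big).$$ Moreover, when $k > 1$, letting $$F := C_k \sqcup \Big(\bigsqcup_{i=1}^{n-k} S_0\Big),$$ one has $A_F \preceq A_G$, and $F$ has successor-closed counting polynomial $$A_F(x) = (1+x)^{n-k}\big(1 + x^k\big).$$
   Context: All digraphs are finite directed graphs $G=(V,E)$ without self-loops. For a vertex $u$, $G(u)$ denotes the set of vertices $v$ with an edge $u\to v$. A digraph is functional if every vertex has out-degree at most one. The symbol $\sqcup$ denotes disjoint union of digraphs. A set $Q\subseteq V$ is successor-closed if $G(u)\subseteq Q$ for every $u\in Q$ (no edge leaves $Q$). The successor-closed counting polynomial of $G$ is $A_G(x) := \sum_{Q} x^{|Q|}$, the sum ranging over all successor-closed subsets $Q$ of $V$. For real polynomials, $A\preceq B$ (coefficient-wise order) means that for every $t\in\mathbb{N}$ the coefficient of $x^t$ in $A$ is at most the coefficient of $x^t$ in $B$. $S_s$ (vertex-rooted star) is the digraph consisting of a root vertex and $s$ leaves, with one edge from each leaf to the root; $S_0$ is a single isolated vertex. $C_\ell$ is the directed cycle $u_1\to u_2\to\cdots\to u_\ell\to u_1$ on $\ell$ vertices. *)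

(* Defs.v *)
From HB Require Import structures.
From mathcomp Require Import all_boot all_order all_algebra.

Set Implicit Arguments.
Unset Strict Implicit.
Unset Printing Implicit Defensive.

Import Order.TTheory GRing.Theory Num.Theory.

Local Open Scope ring_scope.

Record digraph := Digraph {
  vertex : finType;
  edge : rel vertex;
  edge_irr : irreflexive edge
}.

Definition succs (G : digraph) (u : vertex G) : {set vertex G} :=
  [set v | edge u v].

Definition num_vertices (G : digraph) : nat := #|vertex G|.

Definition num_edges (G : digraph) : nat :=
  #|[set p : vertex G * vertex G | edge p.1 p.2]|.

Definition functional (G : digraph) : Prop :=
  forall u : vertex G, (#|succs u| <= 1)%N.

Definition succ_closed (G : digraph) (Q : {set vertex G}) : bool :=
  [forall u in Q, succs u \subset Q].

Definition succ_closed_poly (R : nzSemiRingType) (G : digraph) : {poly R} :=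
  \sum_(Q : {set vertex G} | succ_closed Q) 'X^#|Q|.

Definition coef_le (R : numDomainType) (A B : {poly R}) : Prop :=
  forall t : nat, A`_t <= B`_t.

Definition dunion_edge (G H : digraph) : rel (vertex G + vertex H) :=
  fun x y => match x, y with
             | inl u, inl v => edge u v
             | inr u, inr v => edge u v
             | _, _ => false
             end.

Lemma dunion_edge_irr (G H : digraph) : irreflexive (@dunion_edge G H).
Proof. by case=> u; apply: edge_irr. Qed.

Definition dunion (G H : digraph) : digraph := Digraph (@dunion_edge_irr G H).

(* When the tags agree, [tagged_as x y] is [tagged y] transported to the
   component of [x]. *)
Definition bigdunion_edge (I : finType) (G : I -> digraph) :
    rel {i : I & vertex (G i)} :=
  fun x y => (tag x == tag y) && edge (tagged x) (tagged_as x y).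

Lemma bigdunion_edge_irr (I : finType) (G : I -> digraph) :
  irreflexive (@bigdunion_edge I G).
Proof.
by case=> i u; rewrite /bigdunion_edge eqxx /= tagged_asE edge_irr.
Qed.

Definition bigdunion (I : finType) (G : I -> digraph) : digraph :=
  Digraph (@bigdunion_edge_irr I G).

(* [None] is the root, [Some i] are the leaves. *)
Definition star_edge (s : nat) : rel (option 'I_s) :=
  fun u v => (u != None) && (v == None).

Lemma star_edge_irr (s : nat) : irreflexive (@star_edge s).
Proof. by case. Qed.

Definition star (s : nat) : digraph := Digraph (@star_edge_irr s).

(* [ordS] is the cyclic successor on ['I_l]; [l > 1] excludes the self-loop
   of a cycle on one vertex. *)
Definition dcycle_edge (l : nat) : rel 'I_l := fun u v => v == ordS u.

Lemma dcycle_edge_irr (l : nat) (l_gt1 : (1 < l)%N) :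
  irreflexive (@dcycle_edge l).
Proof.
case=> i lt_il; apply/negbTE/eqP => /(congr1 val) /= eq_i.
case: (ltngtP i.+1 l) lt_il => // [lt_i1l _|eq_i1l _].
  by move: eq_i; rewrite modn_small // => /n_Sn.
by move: eq_i l_gt1; rewrite -eq_i1l modnn => ->.
Qed.

Definition dcycle (l : nat) (l_gt1 : (1 < l)%N) : digraph :=
  Digraph (dcycle_edge_irr l_gt1).

(* Main.v *)
(* Let N be the set of the k vertices of out-degree one and S its complement,
   the n - k sinks.

   Upper bound: fix a sink r. Up to degree-preserving bijection, A_H counts the
   sets that contain r or lie inside S \ {r}. A successor-closed Q is such a set
   unless it avoids r and contains an edge u -> v; then map it to
   (Q \ {v}) + {r}. This map is injective, because v is recovered as the only
   vertex that is missed by an edge leaving the image.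

   Lower bound: all subsets of S are successor-closed, so it suffices to inject
   the subsets T of S into the successor-closed sets of size k + |T| that meet N.
   Let D be the set of sinks of positive in-degree. Since the edges have at most
   k targets, there are at least |D| sources in N, so there is an injection l
   from D to the sources of N. Send T to T + N with each d in D \ T added and
   l(d) removed. The image meets N unless l(D \ T) = N; then G is a perfect
   matching N -> D plus isolated vertices, T misses D, and we take instead
   T + (D \ {d0}) + {u0} for an edge u0 -> d1 with d1 <> d0 (this needs k > 1).
   The latter sets do not contain D, whereas the regular images do. *)
Require Import Defs.
From mathcomp Require Import all_boot all_order all_algebra.

Set Implicit Arguments.
Unset Strict Implicit.
Unset Printing Implicit Defensive.

Import Order.TTheory GRing.Theory Num.Theory.

Local Open Scope ring_scope.

(** * Generating functions of set families and their coefficient-wise comparison *)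

Lemma sum_subsets_Xn (R : comNzRingType) (T : finType) (A : {set T}) :
  \sum_(Q : {set T} | Q \subset A) 'X^#|Q| = (1 + 'X) ^+ #|A| :> {poly R}.
Proof.
rewrite -prodr_const [RHS]big_mkcond /=.
(* Expanding this product, the term of [Q] takes the first summand at each element of [Q]; an
   element outside [A] makes it vanish. *)
transitivity (\prod_(i : T) ((if i \in A then 'X else 0) + 1) : {poly R}).
  rewrite bigA_distr big_mkcond; apply: eq_bigr => /= Q _.
  case: ifP => [sQA | /negbT/subsetPn[x xQ xA]].
    rewrite -prodr_const big_mkcond.
    by apply: eq_bigr => i _; case: ifP => // /(subsetP sQA) ->.
  by rewrite (bigD1 x) //= xQ (negbTE xA) mul0r.
by apply: eq_bigr => i _; case: ifP => _; rewrite ?add0r // addrC.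
Qed.

Lemma sum_contains_Xn (R : comNzRingType) (T : finType) (r : T) :
  \sum_(Q : {set T} | r \in Q) 'X^#|Q| = 'X * (1 + 'X) ^+ #|T|.-1 :> {poly R}.
Proof.
rewrite -(cardsC1 r) -sum_subsets_Xn big_distrr /=.
rewrite (reindex_onto (fun Q => r |: Q) (fun Q => Q :\ r)) /=; last first.
  by move=> Q rQ; rewrite setD1K.
have r_notin (Q : {set T}) : (Q \subset [set~ r]) = (r \notin Q).
  by rewrite subsetC sub1set inE.
apply: eq_big => [Q | Q /andP[_ /eqP defQ]].
  rewrite r_notin setU11; apply/eqP/idP => [<-|rQ]; last by rewrite setU1K.
  by rewrite setD11.
by rewrite cardsU1 -{1}defQ setD11 exprS.
Qed.

Lemma sum_contains_or_subset_Xn (R : comNzRingType) (T : finType) (r : T)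
    (B : {set T}) : r \notin B ->
  \sum_(Q : {set T} | (r \in Q) || (Q \subset B)) 'X^#|Q|
    = 'X * (1 + 'X) ^+ #|T|.-1 + (1 + 'X) ^+ #|B| :> {poly R}.
Proof.
move=> rB; rewrite (bigID (fun Q : {set T} => r \in Q)) /=.
rewrite -(sum_contains_Xn R r) -(sum_subsets_Xn R B).
congr (_ + _); apply: eq_bigl => Q; first by case: (r \in Q); rewrite ?andbF.
case rQ: (r \in Q); rewrite /= ?andbT //.
by apply/esym/negbTE; apply: contra rB => /subsetP; apply.
Qed.

(** A weight-preserving injection identifies the left sum with the part of the right sum over its
    image; the other terms have nonnegative coefficients. *)
Lemma coef_le_inj (R : numDomainType) (I J : finType) (P : pred I) (P' : pred J)
    (w : I -> nat) (w' : J -> nat) (f : I -> J) :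
    {in P &, injective f} -> (forall i, P i -> P' (f i)) ->
    (forall i, P i -> w' (f i) = w i) ->
  @coef_le R (\sum_(i | P i) 'X^(w i)) (\sum_(j | P' j) 'X^(w' j)).
Proof.
move=> f_inj fP fw t; rewrite !coef_sum.
rewrite (bigID (mem (f @: P))) /=.
rewrite [X in _ <= X + _](_ : _ = \sum_(j in f @: P) ('X^(w' j) : {poly R})`_t).
  rewrite big_imset //= -[leLHS]addr0 lerD //.
    by apply: ler_sum => i Pi; rewrite fw.
  by apply: sumr_ge0 => j _; rewrite coefXn ler0n.
apply: eq_bigl => j; case: imsetP => [[i Pi ->]|]; rewrite ?andbF ?andbT //.
exact: fP.
Qed.

Lemma coef_leD (R : numDomainType) (A A' B B' : {poly R}) :
  coef_le A A' -> coef_le B B' -> coef_le (A + B) (A' + B').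
Proof. by move=> leA leB t; rewrite !coefD lerD. Qed.

(** * Polynomials of the extremal digraphs *)

Lemma poly_edgeless (R : comNzRingType) (G : digraph) :
    (forall u v : vertex G, edge u v = false) ->
  succ_closed_poly R G = (1 + 'X) ^+ num_vertices G.
Proof.
move=> noE; rewrite /num_vertices -cardsT -sum_subsets_Xn; apply: eq_bigl => Q.
rewrite subsetT; apply/forall_inP => u _; apply/subsetP => v.
by rewrite inE noE.
Qed.

Lemma poly_bigdunion_star0 (R : comNzRingType) (m : nat) :
  succ_closed_poly R (bigdunion (fun _ : 'I_m => star 0)) = (1 + 'X) ^+ m.
Proof.
rewrite poly_edgeless => [|[i [[]//|]] [j [[]//|]]]; last first.
  rewrite /edge /= /bigdunion_edge /=; apply/negbTE/nandP; right.
  by rewrite /star_edge.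
rewrite /num_vertices /= card_tagged; congr (_ ^+ _).
rewrite sumnE big_map big_enum /=.
rewrite (eq_bigr (fun=> 1%N)) => [|i _]; last by rewrite card_option card_ord.
by rewrite sum1_card card_ord.
Qed.

(** A nonempty closed set contains the root, and any set containing the root is closed. *)
Lemma poly_star (R : comNzRingType) (k : nat) :
  succ_closed_poly R (star k) = 1 + 'X * (1 + 'X) ^+ k.
Proof.
transitivity
  (\sum_(Q : {set option 'I_k} | (None \in Q) || (Q \subset set0))
     'X^#|Q| : {poly R}); last first.
  rewrite sum_contains_or_subset_Xn ?inE // cards0 expr0 addrC.
  by rewrite card_option card_ord.
apply: eq_bigl => Q; rewrite subset0.
apply/forall_inP/orP => [clQ | [rQ|/eqP->] [i|] uQ].
- have [->|[[i|] iQ]] := set_0Vmem Q; [by right | | by left].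
  by left; have /subsetP := clQ _ iQ; apply; rewrite inE.
- by apply/subsetP => -[j|]; rewrite inE.
- by apply/subsetP => -[j|]; rewrite inE.
- by rewrite inE in uQ.
- by rewrite inE in uQ.
Qed.

Lemma poly_dcycle (R : comNzRingType) (k : nat) (k_gt1 : (1 < k)%N) :
  succ_closed_poly R (dcycle k_gt1) = 1 + 'X^k.
Proof.
transitivity
  (\sum_(Q : {set 'I_k} | Q \in [set set0; setT]) 'X^#|Q| : {poly R}).
  apply: eq_bigl => Q; rewrite !inE.
  apply/forall_inP/orP => [clQ | [/eqP->|/eqP->] u]; last first.
  - by rewrite subsetT.
  - by rewrite inE.
  - have [->|[i iQ]] := set_0Vmem Q; [by left | right].
    have iterQ m : iter m (@ordS k) i \in Q.
      elim: m => //= m IHm; have /subsetP := clQ _ IHm; apply.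
      by rewrite inE /edge /= /dcycle_edge.
    have iterE m : (iter m (@ordS k) i = ((i : 'I_k) + m) %% k :> nat)%N.
      elim: m => [|m IHm] /=; first by rewrite addn0 modn_small.
      by rewrite IHm -addn1 modnDml addn1 addnS.
    rewrite -subTset; apply/subsetP => j _.
    (* From [i], the first [k - i] steps wrap around to 0 and [j] more reach [j]; so a nonempty
       closed set is everything. *)
    have -> : j = iter (k - (i : 'I_k) + (j : 'I_k)) (@ordS k) i :> 'I_k.
      apply: val_inj; rewrite /= iterE addnA subnKC ?(ltnW (ltn_ord i)) //.
      by rewrite modnDl modn_small.
    exact: iterQ.
rewrite big_setU1 ?big_set1 /=; first by rewrite cards0 cardsT card_ord.
rewrite inE; apply/eqP => /(congr1 (fun A : {set 'I_k} => #|A|)).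
by rewrite cards0 cardsT card_ord => k0; move: (k_gt1); rewrite -k0.
Qed.

Lemma poly_dunion (R : comNzRingType) (G H : digraph) :
  succ_closed_poly R (dunion G H) = succ_closed_poly R G * succ_closed_poly R H.
Proof.
rewrite /succ_closed_poly big_distrlr /= pair_big /=.
pose join (p : {set vertex G} * {set vertex H}) : {set vertex G + vertex H} :=
  (inl @: p.1) :|: (inr @: p.2).
have inlE p u : (inl u \in join p) = (u \in p.1).
  rewrite inE mem_imset; last by move=> ? ? [].
  by case: imsetP => [[]|]; rewrite ?orbF.
have inrE p u : (inr u \in join p) = (u \in p.2).
  rewrite inE mem_imset; last by move=> ? ? [].
  by case: imsetP => [[]|].
rewrite (reindex join) /=; last first.
  exists (fun Q : {set vertex G + vertex H} =>
      ([set u | inl u \in Q], [set u | inr u \in Q])) => [[A B] _|Q _].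
    by rewrite /=; congr (_, _); apply/setP => u; rewrite inE ?inlE ?inrE.
  by apply/setP => -[u|u]; rewrite ?inlE ?inrE inE.
apply: eq_big => [[A B]|[A B] _] /=.
  apply/forall_inP/andP => /= [clQ | [/forall_inP clA /forall_inP clB]].
    split; apply/forall_inP => u uQ; apply/subsetP => v; rewrite inE => uv.
      have /clQ/subsetP/(_ (inl v)) : inl u \in join (A, B) by rewrite inlE.
      by rewrite inlE inE; apply.
    have /clQ/subsetP/(_ (inr v)) : inr u \in join (A, B) by rewrite inrE.
    by rewrite inrE inE; apply.
  move=> [u|u]; rewrite ?inlE ?inrE => uQ; apply/subsetP => -[v|v];
    rewrite ?inlE ?inrE inE // => uv.
    by apply: (subsetP (clA u uQ)); rewrite inE.
  by apply: (subsetP (clB u uQ)); rewrite inE.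
rewrite -exprD /join cardsU !card_imset /=; [|by move=> ? ? []..].
rewrite (_ : _ :&: _ = set0) ?cards0 ?subn0 //.
apply/setP => -[u|u]; rewrite !inE.
  by apply/andP => -[/imsetP[]// ? ? ? /imsetP[]].
by apply/andP => -[/imsetP[]].
Qed.

(** * Injections between sets; sinks and targets of functional digraphs *)

Lemma exists_set_inj (T : finType) (A B : {set T}) : (#|A| <= #|B|)%N ->
  exists2 f : T -> T, {in A &, injective f} & f @: A \subset B.
Proof.
move=> leAB; exists (fun x => nth x (enum B) (index x (enum A))).
  move=> x y xA yA; have lt_idx z : z \in A -> (index z (enum A) < #|B|)%N.
    by move=> zA; apply: leq_trans leAB; rewrite cardE index_mem mem_enum.
  rewrite (set_nth_default y) -?cardE ?lt_idx // => /eqP.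
  rewrite nth_uniq ?enum_uniq -?cardE ?lt_idx // => /eqP eq_idx.
  by rewrite -(nth_index x (s := enum A) (x := x)) ?mem_enum // eq_idx nth_index
    ?mem_enum.
apply/subsetP => _ /imsetP[x xA ->]; rewrite -mem_enum mem_nth //.
by rewrite -cardE (leq_trans _ leAB) // cardE index_mem mem_enum.
Qed.

Definition nonsinks (G : digraph) : {set vertex G} :=
  [set u | [exists v, edge u v]].

Definition targets (G : digraph) : {set vertex G} :=
  [set v | [exists u, edge u v]].

Lemma functional_edge_inj (G : digraph) : functional G ->
  forall u v w : vertex G, edge u v -> edge u w -> v = w.
Proof.
move=> Gf u v w uv uw; have /card_le1_eqP := Gf u.
by apply; rewrite inE.
Qed.

(** With out-degree at most one, an edge is determined by its tail. *)
Lemma card_nonsinks (G : digraph) : functional G ->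
  #|nonsinks G| = num_edges G.
Proof.
move=> Gf; rewrite /num_edges -(card_in_imset (f := fst)).
  apply: eq_card => u; rewrite inE.
  apply/existsP/imsetP => [[v uv]|[[w v] /= wv ->]].
    by exists (u, v); rewrite ?inE.
  by exists v; rewrite inE in wv.
move=> [u v] [w x] /=; rewrite !inE /= => uv wx eq_uw; subst w.
by congr (_, _); apply: functional_edge_inj uv wx.
Qed.

Lemma card_targets (G : digraph) : (#|targets G| <= num_edges G)%N.
Proof.
apply: leq_trans (leq_imset_card snd _); apply/subset_leq_card/subsetP => v.
by rewrite inE => /existsP[u uv]; apply/imsetP; exists (u, v); rewrite ?inE.
Qed.

Lemma sinks_closed (G : digraph) (Q : {set vertex G}) :
  Q \subset ~: nonsinks G -> succ_closed Q.
Proof.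
move=> sQ; apply/forall_inP => u uQ; apply/subsetP => v; rewrite inE => uv.
have := subsetP sQ u uQ; rewrite !inE => /existsP[]; by exists v.
Qed.

(** * Upper bound: trading the target of an inner edge for a sink *)

Definition swap_target (G : digraph) (r : vertex G) (Q : {set vertex G}) :
    {set vertex G} :=
  if (r \in Q) || (Q \subset ~: nonsinks G) then Q
  else if [pick v in Q | [exists u in Q, edge u v]] is Some v
       then r |: (Q :\ v) else Q.

(** For closed [Q] the [pick] always succeeds, so the final default of [swap_target] does not show
    up as a case. *)
Variant swap_target_spec (G : digraph) (r : vertex G) (Q : {set vertex G}) :
    {set vertex G} -> Prop :=
  | SwapId of (r \in Q) || (Q \subset ~: nonsinks G) : swap_target_spec r Q Q
  | SwapEdge u v of r \notin Q & u \in Q & v \in Q & edge u v :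
      swap_target_spec r Q (r |: (Q :\ v)).

Lemma swap_targetP (G : digraph) (r : vertex G) (Q : {set vertex G}) :
  succ_closed Q -> swap_target_spec r Q (swap_target r Q).
Proof.
move=> /forall_inP clQ; rewrite /swap_target.
case: ifP => [|/negbT]; first by left.
rewrite negb_or => /andP[rQ /subsetPn[u uQ]].
rewrite !inE negbK => /existsP[v uv].
case: pickP => [w /andP[wQ /exists_inP[x xQ xw]]|/(_ v)]; first by right with x.
have -> : v \in Q by apply: (subsetP (clQ u uQ)); rewrite inE.
by move/exists_inP; case; exists u.
Qed.

Lemma swap_target_inj (G : digraph) (r : vertex G) : functional G ->
  r \notin nonsinks G -> {in @succ_closed G &, injective (swap_target r)}.
Proof.
move=> Gf r_sink.
have sink_target u v (Q : {set vertex G}) : r \notin Q -> v \in Q -> edge u v ->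
    u \in Q -> u \in r |: (Q :\ v).
  move=> rQ vQ uv uQ; rewrite !inE uQ andbT orbC; apply/orP; left.
  by apply: contraTneq uv => ->; rewrite edge_irr.
(* A swapped set keeps [u] but loses its successor [v], hence is not closed, whereas sets left fixed
   are. *)
have no_id u v (Q Q' : {set vertex G}) : r \notin Q -> u \in Q -> v \in Q ->
    edge u v -> succ_closed Q' -> r |: (Q :\ v) <> Q'.
  move=> rQ uQ vQ uv /forall_inP clQ' eqQ.
  have uQ' : u \in Q' by rewrite -eqQ (sink_target u v).
  have := subsetP (clQ' u uQ') v; rewrite inE => /(_ uv).
  rewrite -eqQ !inE eqxx /= orbF => /eqP eq_vr.
  by rewrite -eq_vr vQ in rQ.
(* The tail [u] survives in the common image, so it lies in [Q'], and closedness puts [v] there too.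
   As [v] is missing from the image, it must be the removed vertex [v']. *)
have tgt_eq u v v' (Q Q' : {set vertex G}) : r \notin Q -> u \in Q ->
    v \in Q -> edge u v -> r \notin Q' -> v' \in Q' -> succ_closed Q' ->
    r |: (Q :\ v) = r |: (Q' :\ v') -> v = v'.
  move=> rQ uQ vQ uv rQ' vQ' /forall_inP clQ' eqQ.
  have : u \in r |: (Q' :\ v') by rewrite -eqQ (sink_target u v).
  rewrite !inE => /orP[/eqP eq_ur | /andP[_ uQ']].
    by rewrite -eq_ur uQ in rQ.
  have vQ'' : v \in Q' by apply: (subsetP (clQ' u uQ')); rewrite inE.
  apply/eqP/idPn => neq_vv'.
  have : v \in r |: (Q :\ v) by rewrite eqQ !inE neq_vv' vQ'' orbT.
  by rewrite !inE eqxx orbF => /eqP eq_vr; rewrite -eq_vr vQ in rQ.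
move=> Q Q' clQ clQ'.
case: (swap_targetP r clQ) => [_|u v rQ uQ vQ uv];
  case: (swap_targetP r clQ') => [_|u' v' rQ' uQ' vQ' uv'] //.
- by move/esym/(no_id _ _ _ _ rQ' uQ' vQ' uv' clQ).
- by move/(no_id _ _ _ _ rQ uQ vQ uv clQ').
move=> eqQ.
have eq_v := tgt_eq u v v' _ _ rQ uQ vQ uv rQ' vQ' clQ' eqQ; subst v'.
rewrite -(setD1K vQ) -(setD1K vQ'); congr (_ |: _).
rewrite -(setU1K (a := r) (B := Q :\ v)) ?eqQ ?setU1K //.
  by rewrite !inE (negbTE rQ') andbF.
by rewrite !inE (negbTE rQ) andbF.
Qed.

Lemma poly_functional_le (R : realFieldType) (G : digraph) (r : vertex G) :
    functional G -> r \notin nonsinks G ->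
  coef_le (succ_closed_poly R G)
    (\sum_(Q : {set vertex G} | (r \in Q) || (Q \subset (~: nonsinks G) :\ r))
       'X^#|Q|).
Proof.
move=> Gf r_sink; apply: (@coef_le_inj _ _ _ _ _ _ _ (swap_target r)).
- exact: swap_target_inj.
- move=> Q clQ; case: (swap_targetP r clQ) => [|*]; last by rewrite setU11.
  by case rQ: (r \in Q) => //= sQ; rewrite subsetD1 sQ rQ.
- move=> Q clQ; case: (swap_targetP r clQ) => [//|u v rQ uQ vQ uv].
  by rewrite cardsU1 !inE (negbTE rQ) andbF /= (cardsD1 v Q) vQ.
Qed.

(** * Lower bound: padding sets of sinks by [k] vertices *)

Lemma exists_padding (G : digraph) : functional G -> (1 < num_edges G)%N ->
  exists2 phi : {set vertex G} -> {set vertex G},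
    {in [pred T : {set vertex G} | T \subset ~: nonsinks G] &, injective phi} &
    forall T : {set vertex G}, T \subset ~: nonsinks G ->
      [/\ succ_closed (phi T), ~~ (phi T \subset ~: nonsinks G)
        & #|phi T| = (num_edges G + #|T|)%N].
Proof.
move=> Gf; rewrite -card_nonsinks //; set N := nonsinks G => N_gt1.
set D := targets G :\: N.
(* Adding the targets in [N] to both sides turns this into the bound of the number of targets by the
   number of edges. *)
have leD : (#|D| <= #|N :\: targets G|)%N.
  rewrite -(leq_add2l #|targets G :&: N|) cardsID setIC cardsID.
  by rewrite card_nonsinks // card_targets.
have [leaf leaf_inj leaf_sub] := exists_set_inj leD.
have leafP x : x \in D -> (leaf x \in N) && (leaf x \notin targets G).
  by move=> xD; have := subsetP leaf_sub _ (imset_f leaf xD); rewrite inE andbC.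
have tgtP u v : edge u v -> (u \in N) && (v \in targets G).
  move=> uv; rewrite !inE; apply/andP.
  by split; apply/existsP; [exists v | exists u].
have DN x : x \in D -> x \notin N by rewrite inE => /andP[].
(* The witnesses are fixed before [T], so that all exceptional sets share them; they are dummies
   when the exceptional case cannot occur. *)
have [u0 [d1 [d0 match_data]]] : exists u0 d1 d0, N \subset leaf @: D ->
    [/\ edge u0 d1, d1 \in D, d0 \in D & d1 != d0].
  have /card_gt0P[u uN] := ltnW N_gt1.
  move: (uN); rewrite inE => /existsP[d1 ud].
  have d1D : N \subset leaf @: D -> d1 \in D.
    move=> sN; rewrite inE; have /andP[_ ->] := tgtP _ _ ud; rewrite andbT.
    apply/negP => /(subsetP sN)/imsetP[x /leafP/andP[_ + eq_d1]].
    by rewrite -eq_d1; have /andP[_ ->] := tgtP _ _ ud.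
  case: (boolP (N \subset leaf @: D)) => [sN | _]; last by exists u, u, u.
  have : (1 < #|D|)%N.
    apply: leq_trans N_gt1 (leq_trans (subset_leq_card sN) _).
    exact: leq_imset_card.
  rewrite (cardsD1 d1) d1D // ltnS => /card_gt0P[d0].
  rewrite in_setD1 eq_sym => /andP[neq d0D].
  by exists u, d1, d0 => _; split; rewrite ?d1D.
(* [full T] is the exceptional case, where [regular T] would lose all of [N]. *)
pose full (T : {set vertex G}) := N \subset leaf @: (D :\: T).
pose regular (T : {set vertex G}) := (T :|: D) :|: (N :\: leaf @: (D :\: T)).
pose special (T : {set vertex G}) := u0 |: (T :|: D :\ d0).
have fullP T : full T -> [/\ edge u0 d1, d1 \in D, d0 \in D & d1 != d0].
  move=> sN; apply: match_data; apply: subset_trans sN _.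
  exact: imsetS (subsetDl _ _).
have u0N T : full T -> u0 \in N by move/fullP => [/tgtP/andP[]].
(* Here [D :\: T] has at least as many elements as [N], hence as [D], so [T] misses [D]. *)
have full_disj T x : full T -> x \in D -> x \notin T.
  move=> sN; have := leq_trans leD (leq_trans (subset_leq_card (subsetDl _ _))
    (leq_trans (subset_leq_card sN) (leq_imset_card _ _))).
  move=> leDT; have /eqP <- : D :\: T == D by rewrite eqEcard subsetDl.
  by rewrite in_setD => /andP[].
(* A sink [x] in [T] but not in [T'] would lie in [D]; then [leaf x] is kept in [regular T] and
   removed from [regular T']. *)
have regular_sub (T T' : {set vertex G}) : T \subset ~: N -> T' \subset ~: N ->
    regular T = regular T' -> T \subset T'.
  move=> /subsetP sT /subsetP sT' eqT; apply/subsetP => x xT.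
  have := sT x xT; rewrite inE => xN; apply/idPn => xT'.
  have xD : x \in D.
    have : x \in regular T' by rewrite -eqT !(in_setU, xT).
    by rewrite /regular !(in_setU, in_setD) (negbTE xT') (negbTE xN) andbF orbF.
  have /andP[lN lI] := leafP x xD.
  have : leaf x \in regular T.
    rewrite in_setU in_setD lN andbT; apply/orP; right.
    apply/imsetP => -[y]; rewrite in_setD => /andP[yT yD] eq_l.
    by rewrite -(leaf_inj x y xD yD eq_l) xT in yT.
  rewrite eqT => /setUP[/setUP[/sT' | /DN] | /setDP[_]].
  - by rewrite in_setC lN.
  - by rewrite lN.
  - by rewrite imset_f // in_setD xT' xD.
have special_sub (T T' : {set vertex G}) : T \subset ~: N -> full T ->
    special T = special T' -> T \subset T'.
  move=> /subsetP sT fT eqT; apply/subsetP => x xT.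
  have : x \in special T' by rewrite -eqT !in_setU xT orbT.
  rewrite !in_setU in_set1 in_setD1 => /or3P[/eqP eq_x | // | /andP[_ xD]].
    by have := sT x xT; rewrite eq_x inE (u0N T).
  by have := full_disj T x fT xD; rewrite xT.
(* The vertex [d0] separates the two kinds: regular sets contain all of [D], special ones omit
   [d0]. *)
have mixed T T' : full T -> special T <> regular T'.
  move=> fT eqT; have [_ _ d0D _] := fullP T fT.
  have : d0 \in special T by rewrite eqT !in_setU d0D orbT.
  rewrite !in_setU in_setD1 eqxx (negbTE (full_disj T d0 fT d0D)) in_set1 orbF.
  by move/eqP => eq_d0; have := DN _ d0D; rewrite eq_d0 (u0N T).
exists (fun T => if full T then special T else regular T).
  move=> T T' sT sT' /=.
  case: ifP => fT; case: ifP => fT' eqT.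
  - apply/eqP; rewrite eqEsubset (special_sub T T' sT fT eqT) /=.
    exact: special_sub sT' fT' (esym eqT).
  - by case: (mixed _ _ fT eqT).
  - by case: (mixed _ _ fT' (esym eqT)).
  - apply/eqP; rewrite eqEsubset (regular_sub T T' sT sT' eqT) /=.
    exact: regular_sub sT' sT (esym eqT).
move=> T sT; have /subsetP sT1 := sT.
case: ifP => [fT | /negbT nfT].
  have [ud d1D d0D neq] := fullP T fT; split.
  - apply/forall_inP => x; rewrite !in_setU in_set1 => xQ.
    apply/subsetP => v; rewrite inE => xv; have /andP[xN _] := tgtP _ _ xv.
    (* The only nonsink of a special set is [u0], and its unique successor [d1] was kept. *)
    have eq_x : x = u0.
      case/or3P: xQ => [/eqP//|/sT1|]; first by rewrite inE xN.
      by rewrite in_setD1 => /andP[_ /DN]; rewrite xN.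
    rewrite eq_x in xv; rewrite (functional_edge_inj Gf xv ud).
    by rewrite !in_setU in_setD1 neq d1D !orbT.
  - by apply/subsetPn; exists u0; rewrite ?setU11 // inE negbK (u0N T).
  have u0T : u0 \notin T by apply/negP => /sT1; rewrite in_setC (u0N T).
  have u0D : u0 \notin D by apply/negP => /DN; rewrite (u0N T).
  rewrite cardsU1 in_setU in_setD1 (negbTE u0T) (negbTE u0D) andbF.
  (* Fullness gives this equality; dropping [d0] then compensates for adding [u0]. *)
  have -> : #|N| = #|D|.
    apply/eqP; rewrite eqn_leq; apply/andP; split; last first.
      by apply: leq_trans leD _; rewrite subset_leq_card ?subsetDl.
    apply: leq_trans (subset_leq_card fT) _.
    apply: leq_trans (leq_imset_card _ _) _.
    by rewrite subset_leq_card ?subsetDl.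
  rewrite (cardsD1 d0 D) d0D cardsU (_ : _ :&: _ = set0) ?cards0 ?subn0.
    by rewrite add1n addSn addnC.
  apply/setP => x; rewrite in_setI in_setD1 in_set0; apply/and3P => -[xT _ xD].
  by have := full_disj T x fT xD; rewrite xT.
split.
- apply/forall_inP => x; rewrite !in_setU => xQ.
  apply/subsetP => v; rewrite inE => xv; have /andP[_ vI] := tgtP _ _ xv.
  (* A target in [N] is never removed, since leaves are not targets; a target outside [N] lies in
     [D]. *)
  rewrite !in_setU !in_setD vI andbT; case: (boolP (v \in N)) => vN /=.
    rewrite andbT; apply/orP; right; apply/imsetP => -[y].
    by rewrite in_setD => /andP[_ /leafP/andP[_ +]] eq_v; rewrite -eq_v vI.
  by rewrite orbT.
- have /subsetPn[x xN xl] := nfT.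
  apply/subsetPn; exists x; last by rewrite in_setC xN.
  by rewrite in_setU in_setD xl xN orbT.
have sL : leaf @: (D :\: T) \subset N.
  by apply/subsetP => _ /imsetP[x /setDP[/leafP/andP[lN _] _] ->].
rewrite cardsU (_ : _ :&: _ = set0) ?cards0 ?subn0; last first.
  apply/setP => x; rewrite in_setI in_setU in_setD in_set0.
  apply/and3P => -[/orP[/sT1|/DN] + _ xN]; last by rewrite xN.
  by rewrite inE xN.
rewrite (cardsD N) (setIidPr sL) card_in_imset; last first.
  by move=> x y /setDP[xD _] /setDP[yD _]; apply: leaf_inj.
(* In this disjoint form, the vertices of [D :\: T] added to [T] balance their removed leaves. *)
have -> : T :|: D = T :|: (D :\: T).
  by apply/setP => x; rewrite !inE; case: (x \in T).
have leDT : (#|D :\: T| <= #|N|)%N.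
  apply: leq_trans (subset_leq_card (subsetDl _ _)) _.
  by apply: leq_trans leD _; rewrite subset_leq_card ?subsetDl.
rewrite cardsU (_ : _ :&: _ = set0) ?cards0 ?subn0; last first.
  by apply/setP => x; rewrite !inE; case: (x \in T).
by rewrite -addnA subnKC // addnC.
Qed.

Lemma card_sinks (G : digraph) : functional G ->
  #|~: nonsinks G| = (num_vertices G - num_edges G)%N.
Proof.
move=> Gf; rewrite -card_nonsinks // /num_vertices.
by rewrite -(cardsC (nonsinks G)) addKn.
Qed.

Lemma poly_functional_ge (R : realFieldType) (G : digraph) :
    functional G -> (1 < num_edges G)%N ->
  coef_le ((1 + 'X) ^+ (num_vertices G - num_edges G) * (1 + 'X^(num_edges G)))
    (succ_closed_poly R G).
Proof.
move=> Gf k_gt1; have [phi phi_inj phiP] := exists_padding Gf k_gt1.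
rewrite -card_sinks // mulrDr mulr1 mulrC -sum_subsets_Xn big_distrr /=.
rewrite /succ_closed_poly.
(* Closed sets of sinks account for the summand 1 of the second factor, the remaining ones receive
   the padded sets. *)
rewrite [X in coef_le _ X](bigID (fun Q : {set _} => Q \subset ~: nonsinks G)).
apply: coef_leD.
  apply: (@coef_le_inj _ _ _ _ _ _ _ id) => // T sT.
  by rewrite sinks_closed.
under eq_bigr => T _ do rewrite -exprD.
apply: (@coef_le_inj _ _ _ _ _ _ _ phi) => // T /phiP[] // clT nT _.
by rewrite clT.
Qed.

Theorem theorem5p1 (R : realFieldType) (G : digraph) (n k : nat)
  (G_functional : functional G)
  (G_vertices : num_vertices G = n)
  (G_edges : num_edges G = k)
  (k_lt_n : (k < n)%N) :
  let H := dunion (star k) (bigdunion (fun _ : 'I_(n - k - 1) => star 0)) in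
  [/\ coef_le (succ_closed_poly R G) (succ_closed_poly R H),
      succ_closed_poly R H
        = (1 + 'X) ^+ (n - k - 1) * (1 + 'X * (1 + 'X) ^+ k)
    & forall k_gt1 : (1 < k)%N,
      let F := dunion (dcycle k_gt1)
                      (bigdunion (fun _ : 'I_(n - k) => star 0)) in
      coef_le (succ_closed_poly R F) (succ_closed_poly R G) /\
      succ_closed_poly R F = (1 + 'X) ^+ (n - k) * (1 + 'X^k)].
Proof.
move=> H.
have polyH : succ_closed_poly R H
    = (1 + 'X) ^+ (n - k - 1) * (1 + 'X * (1 + 'X) ^+ k).
  by rewrite poly_dunion poly_star poly_bigdunion_star0 mulrC.
split=> // [|k_gt1 F]; last first.
  have polyF : succ_closed_poly R F = (1 + 'X) ^+ (n - k) * (1 + 'X^k).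
    by rewrite poly_dunion poly_dcycle poly_bigdunion_star0 mulrC.
  split=> //; rewrite polyF; subst n k.
  exact: poly_functional_ge.
have cardS : #|~: nonsinks G| = (n - k)%N.
  by rewrite card_sinks // G_vertices G_edges.
(* The hypothesis [k < n] enters here: it provides the sink used for the swap. *)
have /card_gt0P[r rS] : (0 < #|~: nonsinks G|)%N by rewrite cardS subn_gt0.
have r_sink : r \notin nonsinks G by rewrite in_setC in rS.
have := poly_functional_le R G_functional r_sink.
rewrite sum_contains_or_subset_Xn ?setD11 // polyH.
have -> : #|(~: nonsinks G) :\ r| = (n - k - 1)%N.
  by rewrite -cardS (cardsD1 r (~: nonsinks G)) rS addKn.
(* Splitting the exponent this way exposes the common factor with exponent [n - k - 1]. *)
have -> : #|vertex G|.-1 = (n - k - 1 + k)%N.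
  rewrite -/(num_vertices G) G_vertices addnC addnBA ?subn_gt0 //.
  by rewrite subnKC ?subn1 // ltnW.
by rewrite mulrDr mulr1 mulrCA -exprD addrC.
Qed.
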